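(* For any ideal $\mathcal{I}$ on $\omega$, $\mathfrak{b}_R(\mathcal{I})$ equals the least cardinal $\kappa$ for which there exists a family $\{E^\alpha_n: n<\omega,\alpha<\kappa\}\subseteq\mathcal{I}$ such that (i) for all $\alpha<\kappa$ and $n\in\omega$: $E^\alpha_n\cap\bigcup_{\beta<\kappa}\bigcup_{m\neq n}E^\beta_m=\emptyset$; and (ii) for every $\langle A_n:n\in\omega\rangle\in\mathcal{P}_\mathcal{I}$ there is $\alpha<\kappa$ with $\bigcup_{n\in\omega}\left(A_n\cap\bigcup_{i\leq n}E^\alpha_i\right)\notin\mathcal{I}$ (where, if no such $\kappa$ exists, the least such cardinal is taken to be $\mathfrak{c}^+$).
   Context: An ideal on $\omega$ is a nonempty family $\mathcal{I}\subseteq\mathcal{P}(\omega)$ closed under finite unions and under subsets, containing all finite sets, and with $\omega\notin\mathcal{I}$; $\mathcal{I}^+=\mathcal{P}(\omega)\setminus\mathcal{I}$. $\mathcal{P}_\mathcal{I}$ is the family of all sequences $\langle A_n:n\in\omega\rangle$ of pairwise disjoint sets $A_n\in\mathcal{I}$ with $\bigcup_n A_n=\omega$. Families $\mathcal{A},\mathcal{B}$ are $\mathcal{I}$-orthogonal if $A\cap B\in\mathcal{I}$ for all $A\in\mathcal{A}$, $B\in\mathcal{B}$; $C\subseteq\omega$ $\mathcal{I}$-separates $(\mathcal{A},\mathcal{B})$ if $A\cap C\in\mathcal{I}$ and $B\setminus C\in\mathcal{I}$ for all $A\in\mathcal{A}$, $B\in\mathcal{B}$. An $\mathcal{I}$-gap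 is a pair $(\mathcal{A},\mathcal{B})$ of $\mathcal{I}$-orthogonal subfamilies of $\mathcal{I}^+$ not $\mathcal{I}$-separated by any set; an $\mathcal{I}$-$(\kappa,\lambda)$-gap has $|\mathcal{A}|=\kappa$, $|\mathcal{B}|=\lambda$. $\mathfrak{b}_R(\mathcal{I})$ is the least $\kappa$ such that there is an $\mathcal{I}$-$(\omega,\kappa)$-gap, and $\mathfrak{b}_R(\mathcal{I})=\mathfrak{c}^+$ if none exists. *)

(* Defs.v *)
From mathcomp Require Import all_boot.
From mathcomp Require Import boolp classical_sets functions cardinality.

Set Implicit Arguments.
Unset Strict Implicit.
Unset Printing Implicit Defensive.

Local Open Scope classical_set_scope.
Local Open Scope card_scope.

Record is_ideal (I : set (set nat)) : Prop := IsIdeal {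
  ideal_nonempty : I !=set0 ;
  ideal_setU : forall A B, I A -> I B -> I (A `|` B) ;
  ideal_sub : forall A B, A `<=` B -> I B -> I A ;
  ideal_finite : forall A, finite_set A -> I A ;
  ideal_proper : ~ I [set: nat] }.

Definition positive (I : set (set nat)) : set (set nat) := ~` I.

(* The family P_I: some of the pieces A n may be empty. *)
Definition ideal_partition (I : set (set nat)) (A : nat -> set nat) : Prop :=
  [/\ forall n, I (A n), trivIset [set: nat] A & \bigcup_n A n = [set: nat]].

Definition orthogonal (I : set (set nat)) (AA BB : set (set nat)) : Prop :=
  forall A B, AA A -> BB B -> I (A `&` B).

Definition separates (I : set (set nat)) (C : set nat)
    (AA BB : set (set nat)) : Prop :=
  (forall A, AA A -> I (A `&` C)) /\ (forall B, BB B -> I (B `\` C)).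

Definition is_gap (I : set (set nat)) (AA BB : set (set nat)) : Prop :=
  [/\ AA `<=` positive I, BB `<=` positive I, orthogonal I AA BB
    & ~ exists C, separates I C AA BB].

(* A cardinal is represented by any type of that cardinality; cardinals are
   compared through the relations #<= and #= on full sets. *)
Definition cardinal := Type.

Definition has_gap (I : set (set nat)) (kappa lambda : cardinal) : Prop :=
  exists AA BB : set (set nat),
    [/\ is_gap I AA BB, AA #= [set: kappa] & BB #= [set: lambda]].

Definition is_least_cardinal (P : cardinal -> Prop) (kappa : cardinal) : Prop :=
  P kappa /\ forall lambda : cardinal, P lambda -> [set: kappa] #<= [set: lambda].

Definition is_continuum_succ (kappa : cardinal) : Prop :=
  is_least_cardinal
    (fun lambda => [set: set nat] #<= [set: lambda] /\
                   ~ ([set: lambda] #<= [set: set nat])) kappa.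

(* kappa is the least cardinal with property P, or c^+ if there is none. *)
Definition is_least_or_continuum_succ (P : cardinal -> Prop)
    (kappa : cardinal) : Prop :=
  is_least_cardinal P kappa \/
  (~ (exists lambda, P lambda) /\ is_continuum_succ kappa).

Lemma is_least_or_continuum_succ_uniq (P : cardinal -> Prop)
    (kappa lambda : cardinal) :
  is_least_or_continuum_succ P kappa -> is_least_or_continuum_succ P lambda ->
  [set: kappa] #= [set: lambda].
Proof.
move=> [[Pk mk]|[nP [ck mk]]] [[Pl ml]|[nP' [cl ml]]].
- by apply/card_eqPle; split; [exact: mk|exact: ml].
- by case: nP'; exists kappa.
- by case: nP; exists lambda.
- by apply/card_eqPle; split; [exact: mk|exact: ml].
Qed.

(* kappa represents b_R(I). *)
Definition is_bR (I : set (set nat)) (kappa : cardinal) : Prop :=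
  is_least_or_continuum_succ (has_gap I nat) kappa.

Definition has_bR_family (I : set (set nat)) (kappa : cardinal) : Prop :=
  exists E : kappa -> nat -> set nat,
    [/\ forall alpha n, I (E alpha n),
        forall alpha n,
          E alpha n `&`
            \bigcup_beta \bigcup_(m in [set m | m <> n]) E beta m = set0
      & forall A, ideal_partition I A ->
          exists alpha,
            ~ I (\bigcup_n (A n `&`
                  \bigcup_(i in [set i | (i <= n)%N]) E alpha i))].

(* Main.v *)
(** From an (omega, kappa)-gap, enumerate the two sides as A_n and B_alpha, make
the A_n disjoint (A'_n) and put E^alpha_n = B_alpha ∩ A'_n: if a partition P
violated (ii), the complement of the union of the sets P_n ∩ (A'_0 ∪ ... ∪ A'_n)
would separate the gap. Conversely, given a family E, put
F_n = ⋃_alpha E^alpha_n and B_alpha = ⋃_n E^alpha_n; a set C separating these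
yields the partition with pieces C ∩ F_(n+1), plus one further point each, which
violates (ii). Discarding the F_n and B_alpha that belong to the ideal leaves a
gap whose second side has size at most kappa. Hence both classes of cardinals
have the same least element, or are both empty. *)

Require Import Defs.
From mathcomp Require Import all_boot.
From mathcomp Require Import boolp classical_sets functions cardinality.

Set Implicit Arguments.
Unset Strict Implicit.
Unset Printing Implicit Defensive.

Local Open Scope classical_set_scope.
Local Open Scope card_scope.

Lemma injective_card_le (T U : Type) (f : T -> U) :
  injective f -> [set: T] #<= [set: U].
Proof.
move=> finj; apply: (@card_le_trans _ _ _ (range f)).
  have /card_eqPle[] // : range f #= [set: T].
  by apply: inj_card_eq => x y _ _; exact: finj.
exact/subset_card_le/subsetT.
Qed.

Lemma card_eq_range (T : pointedType) (K : Type) (A : set T) :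
  A #= [set: K] -> exists f : K -> T, range f = A.
Proof.
move=> /card_esym/pcard_eqP[f]; exists f.
exact: image_eq.
Qed.

Lemma card_eq_sig (T : Type) (A : set T) : A #= [set: {x | A x}].
Proof.
have sE : range (@sval T A) = A.
  by apply/seteqP; split=> [_ [[x Ax] _ <-]|x Ax] //; exists (exist _ x Ax).
rewrite -[X in X #= _]sE.
by apply: inj_card_eq => -[x Ax] [y Ay] _ _ xy; exact: eq_exist.
Qed.

Lemma cantor_card (T : pointedType) : ~ ([set: T -> Prop] #<= [set: T]).
Proof.
move=> /pcard_leTP[f].
have finj : injective f by move=> x y; apply: inj; rewrite inE.
pose D : T -> Prop := fun x => exists2 X, f X = x & ~ X x.
have nD : ~ D (f D) by move=> DfD; case: (DfD) => X /finj ->.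
by apply: (nD); exists D.
Qed.

(* Zorn on the subsets of the product of all X i that every projection maps
   injectively: a maximal one is mapped onto X i0 by some projection, as
   otherwise a point with all its coordinates outside the projections could be
   added. *)
Lemma least_card_family (J : Type) (X : J -> Type) (j : J) :
  exists i0, forall i, [set: X i0] #<= [set: X i].
Proof.
pose P (Z : set (forall i, X i)) :=
  forall i u v, Z u -> Z v -> u i = v i -> u = v.
have [F FP Ftot|Z [PZ Zmax]] := @Zorn_bigcup _ P.
  move=> i u v [A FA Au] [B FB Bv].
  by have [AB|BA] := Ftot _ _ FA FB; [apply: (FP B)|apply: (FP A)] => //;
    [exact: AB|exact: BA].
have [i0 Zi0] : exists i0, forall x : X i0, exists2 u, Z u & u i0 = x.
  apply: contrapT => nosurj.
  have /all_sig[f fP] : forall i, {x : X i | forall u, Z u -> u i <> x}.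
    move=> i; apply: cid; apply: contrapT => nx; apply: nosurj; exists i => x.
    apply: contrapT => nu; apply: nx; exists x => u Zu ux.
    by apply: nu; exists u.
  apply: (Zmax (Z `|` [set f])).
    split; first by move=> u Zu; left.
    by move=> /(_ f (or_intror erefl)) Zf; exact: (fP j f Zf).
  move=> i u v [Zu|->] [Zv|->] // uv; first exact: (PZ i).
    by have := fP i u Zu uv.
  by have := fP i v Zv (esym uv).
have /all_sig2[s sZ sE] x := cid2 (Zi0 x).
exists i0 => i; apply: (@injective_card_le _ _ (fun x => s x i)) => x y xy.
by rewrite -(sE x) -(sE y) (PZ i _ _ (sZ x) (sZ y) xy).
Qed.

Lemma least_cardinal_exists (P : cardinal -> Prop) (kappa : cardinal) :
  P kappa -> exists lambda, is_least_cardinal P lambda.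
Proof.
move=> Pk.
have [[l Pl] lmin] :=
  @least_card_family {l : cardinal | P l} sval (exist _ kappa Pk).
by exists l; split=> // m Pm; exact: (lmin (exist _ m Pm)).
Qed.

(* Indexing least_card_family by all cardinals puts the universe of [cardinal]
   strictly below that of [set], so [nat -> Prop] is a cardinal but [set nat]
   is not. *)
Lemma continuum_succ_exists : exists kappa, is_continuum_succ kappa.
Proof.
apply: (@least_cardinal_exists _ ((nat -> Prop) -> Prop)); split.
  apply: (@injective_card_le _ _ (fun A B : nat -> Prop => A = B)) => A B AB.
  by have /= -> := congr1 (@^~ B) AB.
exact: (@cantor_card (set nat)).
Qed.

(** Below every [Q]-cardinal lies a [P]-cardinal, so a least [P]-cardinal also bounds [Q] from
    below; if [P] is empty then so is [Q], and both take the value c^+. *)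
Lemma least_or_continuum_succ_common (P Q : cardinal -> Prop) :
  (forall k, P k -> Q k) ->
  (forall k, Q k -> exists2 l : cardinal, P l & [set: l] #<= [set: k]) ->
  exists k, is_least_or_continuum_succ P k /\ is_least_or_continuum_succ Q k.
Proof.
move=> PQ QP; have [[k Pk]|nP] := pselect (exists k, P k).
  have [l [Pl lmin]] := least_cardinal_exists Pk.
  exists l; split; left; split=> //; first exact: PQ.
  by move=> m /QP[n Pn]; apply: card_le_trans; exact: lmin.
have [k kP] := continuum_succ_exists; exists k.
by split; right; split=> // -[l /QP[m Pm _]]; apply: nP; exists m.
Qed.

Section Ideal.
Variable I : set (set nat).
Hypothesis hI : is_ideal I.

Lemma ideal_bigcup_lt (A : nat -> set nat) n :
  (forall i, (i < n)%N -> I (A i)) -> I (\bigcup_(i in [set i | (i < n)%N]) A i).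
Proof.
elim: n => [|n IH] AI.
  by apply: (ideal_finite hI); rewrite [X in finite_set X](_ : _ = set0) //;
    apply/seteqP; split=> x // [].
apply: (ideal_sub hI) (ideal_setU hI (IH _) (AI n _)) => //.
  move=> x [i /=]; rewrite ltnS leq_eqVlt => /orP[/eqP -> Ax|lin Ax].
    by right.
  by left; exists i.
by move=> i lin; apply: AI; exact: ltnW.
Qed.

Lemma ideal_partition_fibers (g : nat -> nat) :
  (forall n, I (g @^-1` [set n])) -> ideal_partition I (fun n => g @^-1` [set n]).
Proof.
move=> gI; split=> //.
  by move=> i j _ _ [x [<- <-]].
by apply/seteqP; split=> x // _; exists (g x).
Qed.

Lemma has_gap_bR_family (kappa : cardinal) :
  has_gap I nat kappa -> has_bR_family I kappa.
Proof.
move=> [AA [BB [[_ _ orth nsep] /card_eq_range[A AE] /card_eq_range[B BE]]]].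
pose A' n := A n `\` \bigcup_(i in [set i | (i < n)%N]) A i.
have A'inj i j x : A' i x -> A' j x -> i = j.
  move=> [Ai nAi] [Aj nAj]; case: (ltngtP i j) => // lij.
    by case: nAj; exists i.
  by case: nAi; exists j.
exists (fun b n => B b `&` A' n); split.
- move=> b n; apply: (ideal_sub hI) (orth (A n) (B b) _ _).
  + by move=> x [Bx [Ax _]].
  + by rewrite -AE; exists n.
  + by rewrite -BE; exists b.
- move=> b n; apply/seteqP; split=> x // [[_ Ax] [c _ [m mn [_ A'x]]]].
  by apply: mn; exact: A'inj A'x Ax.
move=> P [PI _ Pcov]; apply: contrapT => allI; apply: nsep.
exists [set x | ~ exists n, P n x /\ exists2 i, (i <= n)%N & A' i x].
split=> C; last first.
  rewrite -BE => -[b _ <-]; apply: contrapT => nI; apply: allI; exists b.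
  move=> bI; apply: nI; apply: (ideal_sub hI) bI => x [Bx /contrapT].
  by move=> [n [Pn [i lin A'i]]]; exists n => //; split=> //; exists i.
rewrite -AE => -[k _ <-].
(* A point of [A k] lies in some [A' i] with i <= k, so inside [P n] with n >= k it would be
   excluded; what remains of [A k] is covered by the first k pieces. *)
apply: (ideal_sub hI) (@ideal_bigcup_lt P k (fun i _ => PI i)).
move=> x [Akx nx].
have [n _ Pnx] : (\bigcup_n P n) x by rewrite Pcov.
exists n => //=; rewrite ltnNge; apply/negP => lkn; apply: nx.
exists n; split=> //.
have exA : exists i, `[< A i x >] by exists k; apply/asboolP.
case: (ex_minnP exA) => i /asboolP Ai imin.
exists i; first by apply: leq_trans lkn; apply/imin/asboolP.
split=> // -[l /= lli Alx].
by have := imin l; rewrite leqNgt lli => /(_ (asboolT Alx)).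
Qed.

Lemma bR_family_has_gap (kappa : cardinal) : has_bR_family I kappa ->
  exists2 lambda : cardinal, has_gap I nat lambda & [set: lambda] #<= [set: kappa].
Proof.
move=> [E [EI Edisj EP]].
pose F n := \bigcup_a E a n.
pose B a := \bigcup_n E a n.
have Finj m n x : F m x -> F n x -> m = n.
  move=> [a _ ax] [b _ bx]; apply: contrapT => mn.
  have : set0 x by rewrite -(Edisj b n); split=> //; exists a => //; exists m.
  by [].
have FB n a : I (F n `&` B a).
  apply: (ideal_sub hI) (EI a n) => x [Fx [m _ Ex]].
  by rewrite (Finj n m x) //; exists a.
have nsep : ~ exists C, (forall n, I (F n `&` C)) /\ (forall a, I (B a `\` C)).
  move=> [C [FC BC]].
  (* [g] sends C ∩ F_n to n-1 and fixes all other points. As [0.-1] is 0, the fibre over 0 also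
     takes in C ∩ F_0. *)
  have /choice[g gP] : forall x, exists k,
      (exists n, [/\ C x, F n x & k = n.-1]) \/
      (~ (C x /\ exists n, F n x) /\ k = x).
    move=> x; have [[Cx [n Fx]]|nx] := pselect (C x /\ exists n, F n x).
      by exists n.-1; left; exists n.
    by exists x; right.
  have gI n : I (g @^-1` [set n]).
    have finI := ideal_finite hI (finite_set1 n).
    apply: (ideal_sub hI)
      (ideal_setU hI (ideal_setU hI (FC 0) (FC n.+1)) finI) => x /= gx.
    have [[m [Cx Fx gE]]|[_ gE]] := gP x; last by right; rewrite /= -gE.
    by left; case: m => [|m] in gE Fx; [left|right; rewrite -gx gE].
  have [a] := EP _ (ideal_partition_fibers gI); apply.
  (* A point of C in [E a i] has [g]-value [i.-1], and [i <= i.-1] leaves only i = 0. *)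
  apply: (ideal_sub hI) (ideal_setU hI (FC 0) (BC a)) => x [n _ [/= gx [i lin Ex]]].
  have Fx : F i x by exists a.
  have [Cx|nCx] := pselect (C x); last by right; split=> //; exists i.
  left; split=> //; have [[m [_ Fmx gE]]|[nx _]] := gP x; last first.
    by case: nx; split=> //; exists i.
  move: lin => /=; rewrite -gx gE (Finj m i x) //.
  by case: i {Ex} Fx => // i _; rewrite /= ltnn.
pose D := [set n | ~ I (F n)].
pose AA := F @` D.
pose BB := [set B a | a in [set a | ~ I (B a)]].
(* The first side must be exactly countable. If all positive [F n] had n < N, the complement of F_0
   ∪ ... ∪ F_(N-1) would separate, since each [B a] meets this finite union in a set of the
   ideal. *)
have infD : infinite_set D.
  move=> /finite_seqP[s sE]; apply: nsep.
  pose N := (\max_(i <- s) i).+1.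
  exists (~` \bigcup_(i in [set i | (i < N)%N]) F i); split=> [n|a].
    have [FnI|nFn] := pselect (I (F n)).
      by apply: (ideal_sub hI) FnI => x [].
    apply: (ideal_finite hI); rewrite [X in finite_set X](_ : _ = set0) //.
    apply/seteqP; split=> x // [Fx]; apply; exists n => //=.
    rewrite ltnS; apply: (@leq_bigmax_seq _ s predT id) => //.
    by have : D n := nFn; rewrite sE.
  have := @ideal_bigcup_lt (fun n => F n `&` B a) N (fun n _ => FB n a).
  apply: (ideal_sub hI) => x [Bx /contrapT[n nN Fx]].
  by exists n.
(* Spelled with [nat -> Prop] to stay in the universe of [cardinal]. Distinct indices may give the
   same [B a], hence only a bound by [kappa]. *)
exists {A : nat -> Prop | BB A}.
  exists AA, BB; split.
  - split.
    + by move=> _ [n nF <-].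
    + by move=> _ [a nB <-].
    + by move=> _ _ [n _ <-] [a _ <-].
    + move=> [C [AC BC]]; apply: nsep; exists C; split=> [n|a].
        have [FnI|nFn] := pselect (I (F n)).
          by apply: (ideal_sub hI) FnI => x [].
        by apply: AC; exists n.
      have [BaI|nBa] := pselect (I (B a)).
        by apply: (ideal_sub hI) BaI => x [].
      by apply: BC; exists a.
  - apply: (@card_eq_trans _ _ _ _ D).
      (* A positive [F m] is nonempty, and disjointness recovers m from any of its points. *)
      apply: inj_card_eq => m n /set_mem nFm _ Fmn.
      have [x Fx] : F m !=set0.
        apply/set0P/eqP => F0; apply: nFm; rewrite F0.
        exact: (ideal_finite hI).
      by apply: (Finj _ _ x) => //; rewrite -Fmn.
    by apply: eq_card_nat.
  - exact: card_eq_sig.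
have /choice[h hP] : forall A : {A : nat -> Prop | BB A}, exists a, B a = sval A.
  by move=> [X BX]; have [a _ BaX] := BX; exists a.
apply: (@injective_card_le _ _ h) => -[X BX] [Y BY] hXY; apply: eq_exist.
by rewrite -[X]/(sval (exist _ X BX)) -hP hXY hP.
Qed.

End Ideal.

Theorem theorem4p1 (I : set (set nat)) (hI : is_ideal I) :
  exists kappa : cardinal,
    is_bR I kappa /\ is_least_or_continuum_succ (has_bR_family I) kappa.
Proof.
apply: least_or_continuum_succ_common => kappa.
  exact: has_gap_bR_family.
exact: bR_family_has_gap.
Qed.
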